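(* Let $n \in \{3,4\} \cup \{k \in \mathbb{Z} : k \ge 6\}$, and let $\mathcal{W}$ be a set of mutually unbiased unit weighing matrices of order $n$ and weight $3$. Then $|\mathcal{W}| \le 3$ if $n \not\equiv 0 \pmod 4$, and $|\mathcal{W}| \le 9$ if $n \equiv 0 \pmod 4$.
   Context: A (unit) weighing matrix of order $n$ and weight $w$, denoted $UW(n,w)$, is an $n\times n$ complex matrix $W$ all of whose entries have absolute value $0$ or $1$ and which satisfies $WW^*=wI_n$, where $W^*$ is the conjugate transpose. Two unit weighing matrices $H,K$ of order $n$ and weight $w$ are unbiased if $HK^*=\sqrt{w}\,L$ for some unit weighing matrix $L$ of order $n$ and weight $w$. A set of unit weighing matrices of the same order and weight is mutually unbiased if any two distinct members are unbiased. *)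

(* Defs.v *)
From mathcomp Require Import all_boot all_order all_algebra.
From mathcomp Require Import complex.
From mathcomp Require Import classical_sets cardinality reals.

Set Implicit Arguments.
Unset Strict Implicit.
Unset Printing Implicit Defensive.

Import Order.TTheory GRing.Theory Num.Theory.
Local Open Scope ring_scope.
Local Open Scope sesquilinear_scope.

Definition unit_weighing (C : numClosedFieldType) (n w : nat)
    (W : 'M[C]_n) : Prop :=
  (forall i j, `|W i j| = 0 \/ `|W i j| = 1) /\ W *m W ^t* = w%:R%:M.

(* [sqrtC] picks the nonnegative root on nonnegative arguments. *)
Definition unbiased (C : numClosedFieldType) (n w : nat)
    (H K : 'M[C]_n) : Prop :=
  exists2 L : 'M[C]_n, unit_weighing w L & H *m K ^t* = sqrtC w%:R *: L.

(* [WW] may a priori be infinite. *)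
Definition mutually_unbiased (C : numClosedFieldType) (n w : nat)
    (WW : set 'M[C]_n) : Prop :=
  (forall W, WW W -> unit_weighing w W) /\
  (forall H K, WW H -> WW K -> H <> K -> unbiased w H K).

(* Main.v *)
Require Import Defs.
From mathcomp Require Import all_boot all_order all_algebra.
From mathcomp Require Import complex ring zify finmap boolp.
From mathcomp Require Import classical_sets cardinality reals.

(** Adjoin the scaled standard basis, that is the matrix [sqrtC w *: 1], to a
    family of [m] mutually unbiased unit weighing matrices of weight [w]: its
    rows meet the rows of the other matrices in inner products of squared
    modulus 0 or [w], so the [m + 1] matrices together form a set of vectors
    of squared norm [w] in which two distinct vectors have an inner product of
    squared modulus 0 or [w].  Such two-angle sets are controlled by the second-order
    Welch inequality ([welch_bound2]), which in dimension [d] gives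
    [2 w (m + 1) <= (d + 1) (m + w)] ([two_angle_bound]).  For [w = 3] this
    says [m <= 3] if [d = 3] and [m <= 9] if [d = 4], and nothing for
    [d >= 5].

    It therefore remains to cut the problem down to dimension 3 or 4.  Two rows
    whose supports share exactly one point have an inner product of modulus 1,
    which is neither 0 nor the square root of 3; hence any two of the 3-element
    supports, from the same matrix or not, share 0, 2 or 3 points.  Meeting is
    then an equivalence relation on the supports, since two pairs inside a
    3-set intersect, and the union of a class is the hull of its members.
    Every row is supported inside a given hull or off it, so the Welch argument
    applies to the columns of one hull ([local_bound]).  As each column of a
    weighing matrix also has weight 3, counting incidences between one support
    and the rows of one matrix shows that a hull has 3 or 4 points
    ([card_hull]).  This gives the bound 9.  The hulls partition the [n]
    columns, so if 4 does not divide [n] some hull has 3 points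
    ([exists_hull3]), and the bound drops to 3. *)

Set Implicit Arguments.
Unset Strict Implicit.
Unset Printing Implicit Defensive.

Import Order.TTheory GRing.Theory Num.Theory.
Local Open Scope ring_scope.

(** * The second-order Welch inequality *)

Definition dotC (C : numClosedFieldType) (A : finType) (x y : A -> C) : C :=
  \sum_a x a * (y a)^*.

Lemma dotCC (C : numClosedFieldType) (A : finType) (x y : A -> C) :
  (dotC x y)^* = dotC y x.
Proof.
rewrite /dotC rmorph_sum; apply: eq_bigr => a _.
by rewrite rmorphM /= conjCK mulrC.
Qed.

(** Both sides are the squared Hilbert-Schmidt norm of the frame operator of
    [x], once through the Gram matrix and once through its entries. *)
Lemma frame_potential (C : numClosedFieldType) (J B : finType)
    (x : J -> B -> C) :
  \sum_j \sum_k `|dotC (x j) (x k)| ^+ 2 =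
  \sum_u \sum_v `|\sum_j x j u * (x j v)^*| ^+ 2.
Proof.
have jk j k : `|dotC (x j) (x k)| ^+ 2 =
    \sum_u \sum_v x j u * (x j v)^* * (x k u * (x k v)^*)^*.
  rewrite normCK dotCC big_distrl; apply: eq_bigr => u _.
  rewrite big_distrr; apply: eq_bigr => v _ /=.
  by rewrite rmorphM /= conjCK; ring.
under eq_bigr do under eq_bigr do rewrite jk.
under eq_bigr do rewrite exchange_big.
rewrite exchange_big; apply: eq_bigr => u _ /=.
under eq_bigr do rewrite exchange_big.
rewrite exchange_big; apply: eq_bigr => v _ /=.
rewrite normCK big_distrl; apply: eq_bigr => j _.
by rewrite rmorph_sum big_distrr.
Qed.

(** Writing [P_sym] for the projection onto symmetric 2-tensors and [T] for the
    frame operator of the vectors [z j = x j (x) x j], the right side minus the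
    left side is, up to a positive factor, the squared distance between [T] and
    the multiple of [P_sym] that has the same trace; [P_sym] has rank
    [#|A| * #|A|.+1 / 2].  The kernel [s] below is twice that of [P_sym]. *)
Lemma welch_bound2 (C : numClosedFieldType) (J A : finType) (x : J -> A -> C) :
  (0 < #|A|)%N ->
  2 * (\sum_j dotC (x j) (x j) ^+ 2) ^+ 2 <=
  (#|A| * #|A|.+1)%:R * \sum_j \sum_k `|dotC (x j) (x k)| ^+ 4.
Proof.
move=> A_gt0.
pose swap (u : A * A) := (u.2, u.1).
pose z j (u : A * A) := x j u.1 * x j u.2.
have zE j k : dotC (z j) (z k) = dotC (x j) (x k) ^+ 2.
  rewrite expr2 /dotC big_distrl /=.
  under [RHS]eq_bigr do rewrite big_distrr /=.
  rewrite pair_big; apply: eq_bigr => -[a b] _ /=.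
  by rewrite /z /= rmorphM; ring.
pose t u v := \sum_j z j u * (z j v)^*.
pose s (u v : A * A) : C := (u == v)%:R + (swap u == v)%:R.
have sumMs (f : A * A -> A * A -> C) :
    \sum_u \sum_v f u v * s u v = \sum_u (f u u + f u (swap u)).
  apply: eq_bigr => u _; rewrite /s.
  under eq_bigr do rewrite mulrDr !mulr_natr 2!mulrb.
  rewrite big_split /= -!big_mkcond /=.
  by congr (_ + _); [rewrite (big_pred1 u)|rewrite (big_pred1 (swap u))] => //
    v /=; rewrite eq_sym.
set N := \sum_j dotC (x j) (x j) ^+ 2.
have zswap j u : z j (swap u) = z j u by rewrite /z mulrC.
have ts : \sum_u \sum_v t u v * s u v = 2 * N.
  rewrite sumMs (eq_bigr (fun u => 2 * t u u)); last first.
    move=> u _; rewrite [in RHS]mulr_natl mulr2n; congr (_ + _).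
    by apply: eq_bigr => j _; rewrite zswap.
  rewrite -big_distrr exchange_big; congr (_ * _).
  by apply: eq_bigr => j _; rewrite -zE.
pose r : C := (#|A| * #|A|.+1)%:R.
have ss : \sum_u \sum_v s u v * s u v = 2 * r.
  rewrite sumMs (eq_bigr (fun u => 2 * s u u)); last first.
    move=> [a b] _; rewrite [in RHS]mulr_natl mulr2n {2 4}/s /swap !eqxx /=.
    by rewrite [X in _ + X = _]addrC !(eq_sym (b,a)).
  rewrite -big_distrr; congr (_ * _); rewrite /= /s big_split /=.
  rewrite (eq_bigr (fun=> 1)) => [|u _]; last by rewrite eqxx.
  rewrite sumr_const card_prod /r mulnS addnC natrD; congr (_ + _).
  rewrite -(pair_bigA _ (fun a b => (swap (a, b) == (a, b))%:R)) /=.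
  rewrite (eq_bigr (fun=> 1)) ?sumr_const // => a _.
  rewrite (bigD1 a) //= eqxx big1 ?addr0 // => b nab.
  by rewrite /swap /= xpair_eqE (negPf nab).
have NC : N^* = N.
  by rewrite rmorph_sum; apply: eq_bigr => j _; rewrite rmorphXn /= dotCC.
have sC u v : (s u v)^* = s u v by rewrite rmorphD /= !conjC_nat.
have tt : \sum_u \sum_v `|t u v| ^+ 2 = \sum_j \sum_k `|dotC (x j) (x k)| ^+ 4.
  rewrite -frame_potential; apply: eq_bigr => j _; apply: eq_bigr => k _.
  by rewrite zE normrX -exprM.
have r_gt0 : 0 < r by rewrite ltr0n muln_gt0 A_gt0.
have : 0 <= \sum_u \sum_v `|r * t u v - N * s u v| ^+ 2.
  by do 2![apply: sumr_ge0 => ? _]; rewrite exprn_ge0.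
have -> : \sum_u \sum_v `|r * t u v - N * s u v| ^+ 2 =
   r * (r * \sum_j \sum_k `|dotC (x j) (x k)| ^+ 4 - 2 * N ^+ 2).
  have e u v : `|r * t u v - N * s u v| ^+ 2 =
     r ^+ 2 * `|t u v| ^+ 2 - r * N * (t u v * s u v)
     - r * N * (t u v * s u v)^* + N ^+ 2 * (s u v * s u v).
    by rewrite !normCK rmorphB !rmorphM /= NC sC conjC_nat -/r; ring.
  under eq_bigr do under eq_bigr do rewrite e.
  under eq_bigr do rewrite !(big_split, sumrN) /= -!big_distrr.
  rewrite !(big_split, sumrN) /= -!big_distrr /=.
  under [X in _ - _ * X + _]eq_bigr do rewrite -rmorph_sum.
  rewrite -rmorph_sum tt ss ts rmorphM /= NC conjC_nat; ring.
by rewrite pmulr_rge0 // subr_ge0.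
Qed.

(** * Sets of vectors with two angles *)

(** The frame condition says that [x] behaves like [M] orthogonal bases of
    norm [sqrtC w].  It fixes the second-order potential of [x], the two-valued
    angles then determine the fourth-order one, and the Welch inequality
    compares the latter with the square of the sum of the fourth powers of the
    norms.  Vanishing vectors are admitted so that the rows supported away from
    a set of columns need not be removed from the family. *)
Lemma two_angle_bound (C : numClosedFieldType) (J A : finType)
    (x : J -> A -> C) (w M : nat) :
  (0 < #|A|)%N -> (0 < w)%N -> (0 < M)%N ->
  (forall j, dotC (x j) (x j) = 0 \/ dotC (x j) (x j) = w%:R) ->
  (forall j k, j != k ->
     `|dotC (x j) (x k)| ^+ 2 = 0 \/ `|dotC (x j) (x k)| ^+ 2 = w%:R) ->
  (forall a b, \sum_j x j a * (x j b)^* = (M * w)%:R *+ (a == b)) ->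
  (2 * w * M <= #|A|.+1 * (M + w.-1))%N.
Proof.
move=> A_gt0 w_gt0 M_gt0 diag off frame.
pose g j k := dotC (x j) (x k).
have S1 : \sum_j g j j = (#|A| * (M * w))%:R.
  rewrite exchange_big (eq_bigr (fun=> (M * w)%:R)) /=; last first.
    by move=> a _; rewrite frame eqxx.
  by rewrite sumr_const -[LHS]mulr_natl -natrM.
have S2 : \sum_j g j j ^+ 2 = (#|A| * (M * w ^ 2))%:R.
  rewrite (eq_bigr (fun j => w%:R * g j j)) => [|j _]; last first.
    by rewrite /g; case: (diag j) => ->; rewrite ?expr0n ?mulr0 ?expr2.
  by rewrite -big_distrr /= S1 -natrM; congr _%:R; ring.
have F2 : \sum_j \sum_k `|g j k| ^+ 2 = (#|A| * (M * w) ^ 2)%:R.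
  rewrite frame_potential (eq_bigr (fun=> ((M * w) ^ 2)%:R)).
    by rewrite sumr_const -[LHS]mulr_natl -natrM.
  move=> a _; rewrite (bigD1 a) //= frame eqxx big1 => [|b nab].
    by rewrite addr0 normr_nat natrX.
  by rewrite frame eq_sym (negPf nab) normr0 expr0n.
(* Each [t = `|g j k| ^+ 2] satisfies [t ^+ 2 = w * t] off the diagonal; on the
   diagonal [t] is 0 or [w ^ 2] and the second summand corrects for this. *)
have F4 : \sum_j \sum_k `|g j k| ^+ 4 =
    w%:R * (\sum_j \sum_k `|g j k| ^+ 2) + (w * w.-1)%:R * \sum_j g j j ^+ 2.
  rewrite !big_distrr -big_split /=; apply: eq_bigr => j _.
  rewrite big_distrr /= (bigD1 j) //= [X in _ = X + _](bigD1 j) //= addrAC.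
  congr (_ + _); last first.
    apply: eq_bigr => k; rewrite eq_sym => /off; rewrite (exprM _ 2 2).
    by rewrite -/(g j k) => -[] ->; rewrite ?expr0n ?mulr0 ?expr2.
  rewrite /g; case: (diag j) => ->; rewrite ?normr0 ?expr0n ?mulr0 ?addr0 //.
  by rewrite normr_nat -!natrX -!natrM -natrD; congr _%:R;
    case: (w) w_gt0 => // v _; rewrite /=; ring.
have := welch_bound2 x A_gt0; rewrite -/g.
under [X in _ <= _ * X -> _]eq_bigr do under eq_bigr do rewrite -/(g _ _).
under eq_bigr do rewrite -/(g _ _).
rewrite F4 S2 F2 -!natrX -!natrM -natrD -natrM ler_nat.
have -> : (2 * (#|A| * (M * w ^ 2)) ^ 2 =
  (#|A| ^ 2 * M * w ^ 3) * (2 * w * M))%N by ring.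
have -> : (#|A| * #|A|.+1 * (w * (#|A| * (M * w) ^ 2) +
     w * w.-1 * (#|A| * (M * w ^ 2))) =
  (#|A| ^ 2 * M * w ^ 3) * (#|A|.+1 * (M + w.-1)))%N by ring.
by rewrite leq_pmul2l // !muln_gt0 ?expn_gt0 A_gt0 M_gt0 w_gt0.
Qed.

(** * Triples that pairwise do not meet in exactly one point *)

Section Hulls.
Variables (T J : finType) (S : J -> {set T}).
Hypothesis card_S : forall j, #|S j| = 3%N.
Hypothesis card_SI : forall j k, #|S j :&: S k| != 1%N.

Definition meets j k := ~~ [disjoint S j & S k].
Definition hull j := (\bigcup_(k | meets j k) S k)%SET.

Lemma meetsP j k : reflect (exists2 t, t \in S j & t \in S k) (meets j k).
Proof.
rewrite /meets -setI_eq0; apply: (iffP (set0Pn _)) => [[t]|[t tj tk]].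
  by rewrite inE => /andP[]; exists t.
by exists t; rewrite inE tj.
Qed.

Lemma meets_refl j : meets j j.
Proof.
have /set0Pn[t tj] : S j != finset.set0 by rewrite -card_gt0 card_S.
by apply/meetsP; exists t.
Qed.

Lemma meets_sym j k : meets j k = meets k j.
Proof. by rewrite /meets disjoint_sym. Qed.

Lemma meets_card j k : meets j k = (1 < #|S j :&: S k|)%N.
Proof.
by rewrite /meets -setI_eq0 -card_gt0 leq_eqVlt eq_sym (negPf (card_SI j k)).
Qed.

(** Two subsets of size at least 2 of the 3-set [S k] have a common point. *)
Lemma meets_trans k j l : meets j k -> meets k l -> meets j l.
Proof.
rewrite !meets_card [S j :&: _]finset.setIC => jk kl.
suff /set0Pn[t] : (S k :&: S j) :&: (S k :&: S l) != finset.set0.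
  rewrite !inE => /andP[/andP[_ tj] /andP[_ tl]].
  by rewrite -meets_card; apply/meetsP; exists t.
rewrite -card_gt0.
have := cardsUI (S k :&: S j) (S k :&: S l).
have /subset_leq_card : (S k :&: S j) :|: (S k :&: S l) \subset S k.
  by rewrite finset.subUset !finset.subsetIl.
by rewrite card_S; lia.
Qed.

Lemma mem_hull j k t : t \in S k -> (t \in hull j) = meets j k.
Proof.
move=> tk; apply/bigcupP/idP => [[l jl tl]|jk]; last by exists k.
by apply: meets_trans jl _; apply/meetsP; exists t.
Qed.

Lemma sub_hull j : S j \subset hull j.
Proof.
by apply/fintype.subsetP => t tj; rewrite (mem_hull _ tj) meets_refl.
Qed.

Lemma hull_eq j k : meets j k -> hull j = hull k.
Proof.
move=> jk; apply: eq_bigl => l; apply/idP/idP; last exact: meets_trans.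
by apply: meets_trans; rewrite meets_sym.
Qed.

(** [K] stands for the rows of a single matrix, every column of which has
    weight 3; the other triples come from the remaining matrices. *)
Section Cover.
Variable K : {set J}.
Hypothesis deg_K : forall t, #|[set k in K | t \in S k]| = 3%N.

Lemma hull_double_count j (B : {set T}) : B \subset hull j ->
  \sum_(k in K | meets j k) #|B :&: S k| = (3 * #|B|)%N.
Proof.
move=> /fintype.subsetP Bj.
under eq_bigr do rewrite -sum1_card.
rewrite (exchange_big_dep [in B]) /=; last by move=> k t _ /setIP[].
rewrite mulnC -sum_nat_const; apply: eq_bigr => t tB.
rewrite sum1dep_card -(deg_K t); apply: eq_card => k; rewrite !inE tB /=.
case tk: (t \in S k); rewrite ?andbF // -(mem_hull j tk) (Bj _ tB).
by rewrite !andbT.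
Qed.

(** Let [r] be the number of triples of [K] meeting [S j].  All their points lie
    in the hull and use up its degrees, so [r = #|hull j|]; each of them has at
    least 2 of the 9 incidences with [S j], so [r <= 4]. *)
Lemma card_hull j : #|hull j| = 3%N \/ #|hull j| = 4%N.
Proof.
pose r := #|[set k in K | meets j k]|.
have rE : r = #|hull j|.
  apply/eqP; rewrite -(@eqn_pmul2l 3) // -(hull_double_count (subxx _)).
  rewrite mulnC -sum_nat_const; apply/eqP/eq_big => k; rewrite inE //.
  move=> /andP[_ jk].
  rewrite -(card_S k); apply: eq_card => t.
  by rewrite inE andb_idl // => /(mem_hull j) ->.
have : (2 * r <= \sum_(k in K | meets j k) #|S j :&: S k|)%N.
  rewrite mulnC -sum_nat_const (eq_bigl (fun k => (k \in K) && meets j k)).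
    by apply: leq_sum => k /andP[_]; rewrite meets_card.
  by move=> k; rewrite inE.
have := subset_leq_card (sub_hull j).
by rewrite (hull_double_count (sub_hull j)) card_S rE; lia.
Qed.

Lemma exists_hull3 : ~~ (4 %| #|T|)%N -> exists j, #|hull j| = 3%N.
Proof.
move=> n4; apply/exists_eqP/contraT.
rewrite negb_exists => /fintype.forallP hull4.
have {}hull4 j : #|hull j| = 4%N.
  by case: (card_hull j) (hull4 j) => // ->.
have memT t : exists k, t \in S k.
  have /set0Pn[k] : [set k in K | t \in S k] != finset.set0.
    by rewrite -card_gt0 deg_K.
  by rewrite inE => /andP[_ tk]; exists k.
pose P := [set hull j | j : J].
have partP : finset.partition P [set: T]%SET.
  apply/and3P; split.
  - apply/eqP/setP => t; rewrite inE; have [k tk] := memT t.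
    apply/bigcupP; exists (hull k); first exact: imset_f.
    by apply: (fintype.subsetP (sub_hull k)).
  - apply/finset.trivIsetP => _ _ /finset.imsetP[j _ ->] /finset.imsetP[k _ ->].
    apply: contraR; rewrite -setI_eq0 => /set0Pn[t].
    rewrite inE => /andP[]; have [l tl] := memT t.
    rewrite !(mem_hull _ tl) => jl kl; apply/eqP/hull_eq.
    by apply: meets_trans jl _; rewrite meets_sym.
  - by apply/finset.imsetP => -[j _ h0]; have := hull4 j; rewrite -h0 cards0.
have := @card_uniform_partition _ 4 P [set: T]%SET _ partP.
rewrite cardsT => cT; rewrite cT ?dvdn_mull // in n4.
by move=> _ /finset.imsetP[j _ ->].
Qed.

End Cover.
End Hulls.

(** * Unit weighing matrices *)

Local Open Scope sesquilinear_scope.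

Lemma mulmx_conj_dotC (C : numClosedFieldType) n (V W : 'M[C]_n) i j :
  (V *m W ^t*) i j = dotC (V i) (W j).
Proof. by rewrite mxE; apply: eq_bigr => a _; rewrite !mxE. Qed.

Section Weighing.
Variables (C : numClosedFieldType) (n w : nat).
Hypothesis w_gt0 : (0 < w)%N.
Implicit Types V W : 'M[C]_n.

Let w_neq0 : w%:R != 0 :> C.
Proof. by rewrite pnatr_eq0 -lt0n. Qed.

Lemma mulmx_adj_comm V : V *m V ^t* = w%:R%:M -> V ^t* *m V = w%:R%:M.
Proof.
move=> VV; have /mulmx1C : (w%:R^-1 *: V) *m V ^t* = 1%:M.
  by rewrite -scalemxAl VV scale_scalar_mx mulVf.
rewrite -scalemxAr => /(canRL (scalerK _)) ->; rewrite ?invr_eq0 //.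
by rewrite invrK scalemx1.
Qed.

Lemma gram_rows V i j : V *m V ^t* = w%:R%:M ->
  dotC (V i) (V j) = w%:R *+ (i == j).
Proof. by move=> VV; rewrite -mulmx_conj_dotC VV mxE. Qed.

Lemma gram_cols V a b : V *m V ^t* = w%:R%:M ->
  \sum_i V i a * (V i b)^* = w%:R *+ (a == b).
Proof.
move=> /mulmx_adj_comm /matrixP /(_ b a); rewrite !mxE eq_sym => <-.
by apply: eq_bigr => i _; rewrite !mxE mulrC.
Qed.

Section Family.
Variables (I : finType) (W : I -> 'M[C]_n).
Hypothesis WP : forall m, unit_weighing w (W m).
Hypothesis W_unbiased : forall m k, m != k -> unbiased w (W m) (W k).

Lemma sqr_norm_entry m i a : `|W m i a| ^+ 2 = (W m i a != 0)%:R.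
Proof.
rewrite -normr_eq0; case: (WP m) => /(_ i a)[] -> _;
by rewrite ?expr0n ?expr1n ?eqxx ?oner_eq0.
Qed.

Lemma gram_family m k i j : (m, i) != (k, j) ->
  `|dotC (W m i) (W k j)| ^+ 2 = 0 \/ `|dotC (W m i) (W k j)| ^+ 2 = w%:R.
Proof.
have [<-|nmk _] := eqVneq m k.
  rewrite xpair_eqE eqxx /= => /negPf nij.
  by rewrite gram_rows ?(proj2 (WP m)) // nij normr0 expr0n; left.
have [L [L01 _] E] := W_unbiased nmk.
rewrite -mulmx_conj_dotC E mxE normrM exprMn -normrX sqrtCK normr_nat.
by case: (L01 i j) => ->; [left|right]; rewrite ?expr0n ?mulr0 ?expr1n ?mulr1.
Qed.

(** The scaled identity is in general not a unit weighing matrix, but its rows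
    have the norms and the angles to the rows of each [W m] that those of one
    more member of the family would have. *)
Definition with_std (o : option I) : 'M[C]_n :=
  if o is Some m then W m else (sqrtC w%:R)%:M.

Lemma with_std_adj o : with_std o *m with_std o ^t* = w%:R%:M.
Proof.
case: o => [m|] /=; first by case: (WP m).
have conj_sq : (sqrtC w%:R)^* = sqrtC w%:R :> C.
  by apply/CrealP/ger0_real; rewrite sqrtC_ge0 ler0n.
by rewrite tr_scalar_mx map_scalar_mx /= conj_sq -scalar_mxM -expr2 sqrtCK.
Qed.

Lemma gram_with_std p q : p != q ->
  `|dotC (with_std p.1 p.2) (with_std q.1 q.2)| ^+ 2 = 0 \/
  `|dotC (with_std p.1 p.2) (with_std q.1 q.2)| ^+ 2 = w%:R.
Proof.
have entry m i j :
    `|dotC (W m i) ((sqrtC w%:R)%:M j)| ^+ 2 = 0 \/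
    `|dotC (W m i) ((sqrtC w%:R)%:M j)| ^+ 2 = w%:R.
  rewrite /dotC (bigD1 j) //= big1 => [|a naj]; last first.
    by rewrite mxE eq_sym (negPf naj) conjC0 mulr0.
  rewrite addr0 mxE eqxx normrM exprMn sqr_norm_entry norm_conjC -normrX sqrtCK.
  by rewrite normr_nat; case: eqP; rewrite ?mul0r ?mul1r; [left|right].
case: p q => [[m|] i] [[k|] j] /= npq; first exact: gram_family.
- exact: entry.
- by rewrite -dotCC norm_conjC; exact: entry.
- left; rewrite (gram_rows _ _ (with_std_adj None)) (_ : i == j = false).
    by rewrite normr0 expr0n.
  by apply: contraNF npq => /eqP ->.
Qed.

(** The rows of the extended family, cut down to the columns in [U], are either
    unchanged or zero, so all their inner products are still known, while the
    column orthogonality gives the frame condition in dimension [#|U|]. *)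
Lemma local_bound (U : {set 'I_n}) :
  (0 < #|U|)%N ->
  (forall m i, [set a | W m i a != 0] \subset U \/
               [disjoint [set a | W m i a != 0] & U]) ->
  (2 * w * #|I|.+1 <= #|U|.+1 * (#|I| + w))%N.
Proof.
move=> U_gt0 split_U.
have split_V o i : (forall a, a \notin U -> with_std o i a = 0) \/
    (forall a, a \in U -> with_std o i a = 0).
  case: o => [m|] /=.
    case: (split_U m i) => [/fintype.subsetP sU|dU]; [left|right] => a aU.
      apply/eqP; apply: contraNT aU => nz; apply: sU.
      by rewrite inE.
    by have := disjointFl dU aU; rewrite inE => /negbFE/eqP.
  case: (boolP (i \in U)) => iU; [left|right] => a aU; rewrite mxE;
  by case: eqP aU => // <-; rewrite ?iU // (negPf iU).
pose x (p : option I * 'I_n) (a : 'I_#|U|) := with_std p.1 p.2 (enum_val a).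
have xE p q : dotC (x p) (x q) =
    \sum_(a in U) with_std p.1 p.2 a * (with_std q.1 q.2 a)^*.
  by rewrite (big_enum_val (fun a => _)).
have x_dot p q : dotC (x p) (x q) = 0 \/
    dotC (x p) (x q) = dotC (with_std p.1 p.2) (with_std q.1 q.2).
  rewrite xE; case: (split_V p.1 p.2) => [out|inn]; [right|left].
    rewrite /dotC [RHS](bigID [in U]) /= [X in _ + X]big1 ?addr0 // => a aU.
    by rewrite out // mul0r.
  by rewrite big1 // => a aU; rewrite inn // mul0r.
have := @two_angle_bound C _ _ x w #|I|.+1 _ w_gt0 isT.
rewrite card_ord addSnnS prednK //; apply=> //.
- move=> p; case: (x_dot p p) => ->; first by left.
  by right; rewrite (gram_rows _ _ (with_std_adj p.1)) eqxx.
- move=> p q npq; case: (x_dot p q) => ->; first by left; rewrite normr0 expr0n.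
  exact: gram_with_std.
- move=> a b.
  rewrite -(pair_bigA _ (fun o i => x (o, i) a * (x (o, i) b)^*)) /=.
  rewrite (eq_bigr (fun=> w%:R *+ (a == b))) => [|o _].
    by rewrite sumr_const card_option -mulrnA mulnC mulrnA natrM mulr_natl.
  by rewrite gram_cols ?with_std_adj // (inj_eq enum_val_inj).
Qed.

End Family.
End Weighing.

Lemma weight3_family_bound (C : numClosedFieldType) n (I : finType)
    (W : I -> 'M[C]_n) :
  (0 < n)%N -> (forall m, unit_weighing 3 (W m)) ->
  (forall m k, m != k -> unbiased 3 (W m) (W k)) ->
  (#|I| <= 9)%N /\ (~~ (4 %| n) -> #|I| <= 3)%N.
Proof.
move=> n_gt0 WP W_unbiased.
have [I0|/card_gt0P[m0 _]] := posnP #|I|; first by rewrite I0.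
pose S (p : I * 'I_n) := [set a | W p.1 p.2 a != 0].
(* Weights of rows and columns are read off from their squared norms in [C]. *)
have natC_inj : injective (fun k => k%:R : C).
  by move=> x y /eqP; rewrite eqr_nat => /eqP.
have sum_sq m (f g : 'I_n -> 'I_n) :
    \sum_i W m (f i) (g i) * (W m (f i) (g i))^* =
    #|[set i | W m (f i) (g i) != 0]|%:R.
  under eq_bigr do rewrite -normCK (sqr_norm_entry WP).
  by rewrite -natr_sum -big_mkcondr sum1dep_card.
have card_S p : #|S p| = 3%N.
  apply: natC_inj; have := gram_rows p.2 p.2 (proj2 (WP p.1)).
  by rewrite eqxx /dotC (sum_sq p.1 (fun=> p.2) id).
have card_SI p q : #|S p :&: S q| != 1%N.
  have [->|npq] := eqVneq p q; first by rewrite finset.setIid card_S.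
  apply/negP => /cards1P[a Sa].
  have mem_S b : (b \in S p :&: S q) = (b == a) by rewrite Sa inE.
  have dot1 : `|dotC (W p.1 p.2) (W q.1 q.2)| ^+ 2 = 1.
    rewrite /dotC (bigD1 a) //= big1 => [|b nba].
      rewrite addr0 normrM exprMn norm_conjC !(sqr_norm_entry WP).
      by have := mem_S a; rewrite !inE eqxx => /andP[-> ->]; rewrite mulr1.
    apply/eqP; rewrite mulf_eq0 conjC_eq0.
    have := mem_S b; rewrite !inE (negPf nba) => /negbT.
    by rewrite negb_and !negbK.
  have := @gram_family _ _ _ _ _ WP W_unbiased p.1 q.1 p.2 q.2.
  rewrite -!surjective_pairing dot1 => /(_ npq)[/eqP|/eqP].
    by rewrite oner_eq0.
  by rewrite (eqr_nat C 1 3).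
(* The rows of the single matrix [W m0] serve as the covering subfamily. *)
have deg_K a : #|[set p in [set p | p.1 == m0] | a \in S p]| = 3%N.
  rewrite (_ : [set p in _ | _] = [set (m0, i) | i in [set i | W m0 i a != 0]]).
    rewrite card_imset; last by move=> i j [].
    apply: natC_inj; have := gram_cols (isT : 0 < 3)%N a a (proj2 (WP m0)).
    by rewrite eqxx (sum_sq m0 id (fun=> a)).
  apply/setP => -[m i]; rewrite !inE /=; apply/andP/imsetP => [[/eqP -> nz]|].
    by exists i; rewrite ?inE.
  by case=> j; rewrite inE => nz [-> ->].
have bound p : (6 * #|I|.+1 <= #|hull S p|.+1 * (#|I| + 3))%N.
  apply: (local_bound _ WP W_unbiased) => //.
    by case: (card_hull card_S card_SI deg_K p) => ->.
  move=> m i; case: (boolP (meets S p (m, i))) => pmi; [left|right].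
    apply/fintype.subsetP => a ami.
    by rewrite (mem_hull card_S card_SI p (k := (m, i))).
  apply/pred0P => a /=; apply/negP => /andP[ami].
  by rewrite (mem_hull card_S card_SI p (k := (m, i))) // (negPf pmi).
split.
  pose p := (m0, Ordinal n_gt0).
  by case: (card_hull card_S card_SI deg_K p) (bound p) => ->; lia.
move=> n4; have [|p p3] := exists_hull3 card_S card_SI deg_K.
  by rewrite card_ord.
by have := bound p; rewrite p3; lia.
Qed.

(** The family may a priori be infinite, whereas the counting arguments need a
    finite index type. *)
Lemma card_le_finite_subsets (T : choiceType) (A : set T) k :
  (forall B : {fset T}, ([set` B] `<=` A)%classic -> (#|` B| <= k)%N) ->
  (A #<= `I_k)%card.
Proof.
move=> bound; have [/finite_fsetP[B AB]|infA] := pselect (finite_set A).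
  have /card_eq_fsetP/card_le_eql BE : #|` B| = #|` B| by [].
  by rewrite AB BE card_le_II bound ?AB.
have [B BA] := infinite_set_fset k.+1 infA.
by rewrite ltnNge bound.
Qed.

Theorem theorem15 (R : realType) (n : nat)
    (hn : [\/ n = 3%N, n = 4%N | (6 <= n)%N])
    (WW : set 'M[R[i]]_n) (hW : mutually_unbiased 3 WW) :
  ((n <> 0 %[mod 4])%N -> (WW #<= `I_3)%card) /\
  ((n = 0 %[mod 4])%N -> (WW #<= `I_9)%card).
Proof.
have n_gt0 : (0 < n)%N by case: hn => [->|->|/ltnW/ltnW/ltnW/ltnW/ltnW].
case: hW => WP W_unbiased.
have bound (B : {fset 'M[R[i]]_n}) : ([set` B] `<=` WW)%classic ->
    (#|` B| <= 9)%N /\ (~~ (4 %| n) -> #|` B| <= 3)%N.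
  move=> BW; rewrite cardfE.
  apply: (@weight3_family_bound _ _ _ val) => // [m|m k nmk].
    exact/WP/BW/valP.
  by apply: W_unbiased; [exact/BW/valP|exact/BW/valP|exact/eqP].
rewrite mod0n; split=> n4; apply: card_le_finite_subsets => B /bound[B9 B3] //.
by apply: B3; exact/eqP.
Qed.
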